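(* Let $L$ be a finite-dimensional Lie algebra over a field $F$. Then every $2$-maximal subalgebra of $L$ is a subideal of $L$ if and only if one of the following holds: (i) $L$ is nilpotent; (ii) $L=N+Fx$ for some $x\in L$, where $N$ is the nilradical of $L$, $N^2=0$ and $\mathrm{ad}\,x$ acts irreducibly on $N$; or (iii) $L$ is simple and every nonzero proper subalgebra of $L$ is one-dimensional.
   Context: A $2$-maximal subalgebra of $L$ is a subalgebra $S_0$ for which there is a chain $S_0<S_1<S_2=L$ of subalgebras with each $S_i$ a maximal subalgebra of $S_{i+1}$. A subideal of $L$ is a subalgebra $I$ for which there is a chain $I=I_0\subseteq I_1\subseteq\cdots\subseteq I_k=L$ of subalgebras with each $I_j$ an ideal of $I_{j+1}$. The nilradical of $L$ is its largest nilpotent ideal. $N^2=[N,N]$. ''$\mathrm{ad}\,x$ acts irreducibly on $N$'' means that $N$ has no nonzero proper subspace invariant under $\mathrm{ad}\,x$. *)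

(* Defs.v *)
From HB Require Import structures.
From mathcomp Require Import all_boot all_order all_algebra.

Set Implicit Arguments.
Unset Strict Implicit.
Unset Printing Implicit Defensive.

Import GRing.Theory.
Local Open Scope ring_scope.

HB.mixin Record Vector_isLieAlgebra (F : fieldType) L of Vector F L := {
  bracket : L -> L -> L;
  bracket_linearl : forall y : L, linear (bracket^~ y);
  bracket_linearr : forall x : L, linear (bracket x);
  bracketxx : forall x : L, bracket x x = 0;
  bracket_jacobi : forall x y z : L,
    bracket x (bracket y z) + bracket y (bracket z x) + bracket z (bracket x y)
      = 0
}.

#[short(type="lieAlgType")]
HB.structure Definition LieAlgebra (F : fieldType) :=
  { L of Vector_isLieAlgebra F L & Vector F L }.

HB.instance Definition _ (F : fieldType) (L : lieAlgType F) (x : L) :=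
  GRing.isLinear.Build F L L *:%R (bracket x) (bracket_linearr x).

Definition ad (F : fieldType) (L : lieAlgType F) (x : L) : 'End(L) :=
  linfun (bracket x).

Lemma adE (F : fieldType) (L : lieAlgType F) (x y : L) : ad x y = bracket x y.
Proof. exact: lfunE. Qed.

(* The subspace spanned by all brackets of an element of U with one of V; it
   suffices to bracket bases, see bracketv_leP. *)
Definition bracketv (F : fieldType) (L : lieAlgType F) (U V : {vspace L}) :
    {vspace L} :=
  <<[seq bracket u v | u <- vbasis U, v <- vbasis V]>>%VS.

Lemma memv_bracket (F : fieldType) (L : lieAlgType F) (U V : {vspace L})
    (u v : L) :
  u \in U -> v \in V -> bracket u v \in bracketv U V.
Proof.
move=> Uu Vv.
have linl w : bracket u w = \sum_i coord (vbasis U) i u *: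
    bracket (vbasis U)`_i w.
  rewrite {1}(coord_vbasis Uu).
  pose f := GRing.isLinear.Build F L L *:%R (bracket^~ w) (bracket_linearl w).
  pose g : {linear L -> L} := HB.pack (bracket^~ w) f.
  by rewrite -[LHS]/(g _) linear_sum; apply: eq_bigr => i _; rewrite linearZ.
rewrite linl; apply: memv_suml => i _; apply: memvZ.
rewrite {1}(coord_vbasis Vv) linear_sum; apply: memv_suml => j _.
rewrite linearZ; apply: memvZ; apply: memv_span; apply: allpairs_f;
  by apply: mem_nth; rewrite size_tuple.
Qed.

Lemma bracketv_leP (F : fieldType) (L : lieAlgType F) (U V W : {vspace L}) :
  reflect (forall u v, u \in U -> v \in V -> bracket u v \in W)
          (bracketv U V <= W)%VS.
Proof.
apply: (iffP idP) => [sUVW u v Uu Vv | memW].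
  exact: subvP sUVW _ (memv_bracket Uu Vv).
by apply/span_subvP => _ /allpairsP[[u v] /= [Uu Vv ->]];
  apply: memW; apply: vbasis_mem.
Qed.

Definition is_subalgebra (F : fieldType) (L : lieAlgType F)
    (S : {vspace L}) : bool :=
  (bracketv S S <= S)%VS.

Definition is_ideal_of (F : fieldType) (L : lieAlgType F)
    (I S : {vspace L}) : bool :=
  (I <= S)%VS && (bracketv S I <= I)%VS.

Definition is_ideal (F : fieldType) (L : lieAlgType F) (I : {vspace L}) : bool :=
  is_ideal_of I fullv.

Definition maximal_subalgebra_of (F : fieldType) (L : lieAlgType F)
    (M S : {vspace L}) : Prop :=
  [/\ is_subalgebra M, (M <= S)%VS, M <> S &
      forall T : {vspace L}, is_subalgebra T ->
        (M <= T)%VS -> (T <= S)%VS -> T = M \/ T = S].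

Definition two_maximal_subalgebra (F : fieldType) (L : lieAlgType F)
    (S0 : {vspace L}) : Prop :=
  exists S1 : {vspace L},
    maximal_subalgebra_of S0 S1 /\ maximal_subalgebra_of S1 fullv.

Definition is_subideal (F : fieldType) (L : lieAlgType F)
    (I : {vspace L}) : Prop :=
  exists (k : nat) (J : nat -> {vspace L}),
    [/\ J 0%N = I, J k = fullv,
        forall j, (j <= k)%N -> is_subalgebra (J j) &
        forall j, (j < k)%N -> is_ideal_of (J j) (J j.+1)].

Definition lower_central (F : fieldType) (L : lieAlgType F)
    (S : {vspace L}) (n : nat) : {vspace L} :=
  iter n (bracketv S) S.

Definition is_nilpotent (F : fieldType) (L : lieAlgType F)
    (S : {vspace L}) : Prop :=
  exists n : nat, lower_central S n = 0%VS.

Definition is_nilradical (F : fieldType) (L : lieAlgType F)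
    (N : {vspace L}) : Prop :=
  [/\ is_ideal N, is_nilpotent N &
      forall I : {vspace L}, is_ideal I -> is_nilpotent I -> (I <= N)%VS].

Definition acts_irreducibly (F : fieldType) (L : lieAlgType F)
    (f : 'End(L)) (N : {vspace L}) : Prop :=
  forall W : {vspace L},
    (W <= N)%VS -> (f @: W <= W)%VS -> W = 0%VS \/ W = N.

Definition is_simple (F : fieldType) (L : lieAlgType F) : Prop :=
  bracketv (@fullv F L) fullv <> 0%VS /\
  forall I : {vspace L}, is_ideal I -> I = 0%VS \/ I = fullv.

(* Main.v *)
(* Suppose every 2-maximal subalgebra is a subideal, and let M be a maximal
   subalgebra of L that is not an ideal. A maximal subalgebra S of M is
   normalized both by M and by the first term of its subideal chain that
   leaves M, hence S is an ideal of L. Two distinct such S would add up to M,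
   which is not an ideal; but if z in M \ {0} did not span M, then z would
   lie in such an S, and an element of M \ S, which cannot span M either,
   would lie in another one. So M is a line.
   If L is not nilpotent, Engel's theorem yields x with ad x not nilpotent.
   By Fitting, no proper ideal contains the null component of ad x, so a
   maximal subalgebra containing it is not an ideal, hence is F x, and no
   proper ideal contains x. If L is not simple, it follows that L = I + F x
   for each nonzero proper ideal I, so that [L, L] is the only such ideal.
   Its elements are ad-nilpotent by the above, hence it is nilpotent, hence
   abelian. *)
Require Import Defs.
From mathcomp Require Import all_boot all_order all_algebra.
From Stdlib Require Import Classical.

Set Implicit Arguments.
Unset Strict Implicit.
Unset Printing Implicit Defensive.

Import GRing.Theory.
Local Open Scope ring_scope.

Section LieAlgebraTheory.
Variables (F : fieldType) (L : lieAlgType F).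
Implicit Types (x y z u v w : L) (S T U V W I J M N : {vspace L}).

(** * Bracket identities, subalgebras and ideals *)

Lemma bracketDl x y z : bracket (x + y) z = bracket x z + bracket y z.
Proof. by have := bracket_linearl z 1 x y; rewrite /= !scale1r. Qed.

Lemma bracket0l z : bracket 0 z = 0 :> L.
Proof. by apply: (addIr (bracket 0 z)); rewrite -bracketDl !add0r. Qed.

Lemma bracketZl (c : F) x z : bracket (c *: x) z = c *: bracket x z.
Proof. by have := bracket_linearl z c x 0; rewrite /= bracket0l !addr0. Qed.

Lemma bracketC x y : bracket x y = - bracket y x.
Proof.
apply/eqP; rewrite -addr_eq0; apply/eqP.
by have := bracketxx (x + y);
  rewrite bracketDl !linearD /= !bracketxx addr0 add0r.
Qed.

Lemma bracket_derivation x y z :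
  bracket x (bracket y z) = bracket (bracket x y) z + bracket y (bracket x z).
Proof.
have := bracket_jacobi x y z.
rewrite (bracketC z x) linearN /= (bracketC z (bracket x y)) -addrA -opprD.
by move/subr0_eq; rewrite addrC.
Qed.

Lemma subalgebraP S :
  reflect {in S &, forall u v, bracket u v \in S} (is_subalgebra S).
Proof.
by apply: (iffP (bracketv_leP _ _ _)) => h u v; [exact: h|move=> *; exact: h].
Qed.

Lemma idealP I :
  reflect (forall u v, v \in I -> bracket u v \in I) (is_ideal I).
Proof.
rewrite /is_ideal /is_ideal_of subvf /=.
by apply: (iffP (bracketv_leP _ _ _)) => h u v;
  [apply: h; rewrite memvf|move=> _; exact: h].
Qed.

Lemma bracketvS S U V : (U <= V)%VS -> (bracketv S U <= bracketv S V)%VS.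
Proof.
by move=> /subvP sUV; apply/bracketv_leP => u v Su /sUV Vv; apply: memv_bracket.
Qed.

Lemma ideal_is_subalgebra I : is_ideal I -> is_subalgebra I.
Proof. by move=> /idealP idI; apply/subalgebraP => u v _; apply: idI. Qed.

Lemma fullv_subalgebra : is_subalgebra (@fullv F L).
Proof. by apply/subalgebraP => u v _ _; rewrite memvf. Qed.

Lemma line_subalgebra x : is_subalgebra <[x]>%VS.
Proof.
apply/subalgebraP => _ _ /vlineP[a ->] /vlineP[b ->].
by rewrite bracketZl linearZ /= bracketxx !scaler0 mem0v.
Qed.

Lemma subalgebra_capv S T :
  is_subalgebra S -> is_subalgebra T -> is_subalgebra (S :&: T)%VS.
Proof.
move=> /subalgebraP hS /subalgebraP hT; apply/subalgebraP => u v.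
by rewrite !memv_cap => /andP[Su Tu] /andP[Sv Tv]; rewrite hS // hT.
Qed.

Lemma subalgebra_add_line S x :
  is_subalgebra S -> {in S, forall u, bracket u x \in S} ->
  is_subalgebra (S + <[x]>)%VS.
Proof.
move=> /subalgebraP hS hx; apply/subalgebraP.
move=> _ _ /memv_addP[u Su [_ /vlineP[a ->] ->]]
  /memv_addP[v Sv [_ /vlineP[b ->] ->]].
rewrite bracketDl !linearD /= !bracketZl !linearZ /= bracketxx !scaler0 addr0.
rewrite (bracketC x) scalerN; apply: (subvP (addvSl _ _)).
by rewrite !(memvD, memvN, memvZ, hx, hS).
Qed.

Lemma ideal_add_line_subalgebra I x :
  is_ideal I -> is_subalgebra (I + <[x]>)%VS.
Proof.
move=> idI; apply: subalgebra_add_line (ideal_is_subalgebra idI) _ => u Iu.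
by rewrite bracketC memvN; move/idealP: idI; apply.
Qed.

Lemma ideal_addv I J : is_ideal I -> is_ideal J -> is_ideal (I + J)%VS.
Proof.
move=> /idealP hI /idealP hJ; apply/idealP => u _ /memv_addP[v Iv [w Jw ->]].
by rewrite linearD memv_add ?hI ?hJ.
Qed.

Lemma bracketv_ideal I J : is_ideal I -> is_ideal J -> is_ideal (bracketv I J).
Proof.
move=> /idealP hI /idealP hJ; apply/idealP => x z.
(* The vectors that [ad x] sends into [I, J] form a subspace, so only brackets have to be tested; on
   these [ad x] acts as a derivation. *)
pose W := (lfun_preim (ad x) (bracketv I J))%VS.
suff : (bracketv I J <= W)%VS.
  by move=> /subvP sW /sW; rewrite -memv_preim adE.
apply/bracketv_leP => u v Iu Jv.
by rewrite -memv_preim adE bracket_derivation memvD ?memv_bracket ?hI ?hJ.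
Qed.

(** * Maximal subspaces and maximal subalgebras *)

Lemma properv_exists U V :
  (U <= V)%VS -> U <> V -> exists2 v, v \in V & v \notin U.
Proof.
move=> sUV neUV; have /subvPn[v] : ~~ (V <= U)%VS.
  by apply/negP => sVU; apply: neUV; apply/eqP; rewrite eqEsubv sUV.
by exists v.
Qed.

Lemma properv_dim U V : (U <= V)%VS -> U <> V -> (\dim U < \dim V)%N.
Proof.
move=> sUV neUV; rewrite ltnNge; apply/negP => leVU.
by apply: neUV; apply/eqP; rewrite eqEdim sUV.
Qed.

Lemma vspace_neq0 U : U <> 0%VS -> exists2 v, v \in U & v != 0.
Proof.
move=> neU0; have [v] := properv_exists (sub0v U) (not_eq_sym neU0).
by rewrite memv0; exists v.
Qed.

(** The codimension drops at every strict enlargement, so enlarging must stop. [P] is an arbitrary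
    proposition, hence the classical case split on whether an enlargement exists. *)
Lemma vspace_maximum (P : {vspace L} -> Prop) U : P U ->
  exists V, [/\ P V, (U <= V)%VS & forall W, P W -> (V <= W)%VS -> W = V].
Proof.
move: {2}(_ - _)%N (leqnn (\dim {:L} - \dim U)) => n.
elim: n U => [|n IHn] U leUn PU.
  exists U; split=> // W _ sUW; apply/esym/eqP; rewrite eqEdim sUW.
  by rewrite (leq_trans (dimvS (subvf W))) // -subn_eq0 -leqn0.
have [[V [PV sUV neUV]]|noV] :=
  classic (exists V, [/\ P V, (U <= V)%VS & U <> V]).
  have [|W [PW sVW maxW]] := IHn V _ PV.
    rewrite -ltnS; apply: leq_trans leUn; apply: ltn_sub2l (properv_dim sUV neUV).
    exact: leq_trans (properv_dim sUV neUV) (dimvS (subvf V)).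
  by exists W; split=> //; apply: subv_trans sVW.
exists U; split=> // W PW sUW; apply: NNPP => neWU.
by apply: noV; exists W; split=> // eqUW; apply: neWU.
Qed.

(** A maximal subspace inside [P] absorbs the line of every vector satisfying [P]. Null components
    and idealizers, given by undecided predicates, become subspaces this way. *)
Lemma vspace_comprehension (P : L -> Prop) :
    P 0 -> (forall (a : F) u v, P u -> P v -> P (a *: u + v)) ->
  exists U, forall v, v \in U <-> P v.
Proof.
move=> P0 Plin; pose Q U := forall v, v \in U -> P v.
have [|U [QU _ maxU]] := @vspace_maximum Q 0%VS.
  by move=> v; rewrite memv0 => /eqP->.
exists U => v; split=> [/QU //|Pv].
suff <- : (U + <[v]>)%VS = U by rewrite (subvP (addvSr _ _)) ?memv_line.
apply: maxU; last exact: addvSl.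
move=> _ /memv_addP[u Uu [_ /vlineP[a ->] ->]].
by rewrite addrC; apply: Plin => //; apply: QU.
Qed.

Lemma maximal_subalgebra_exists S T :
    is_subalgebra T -> (T <= S)%VS -> T <> S ->
  exists2 M, maximal_subalgebra_of M S & (T <= M)%VS.
Proof.
move=> algT sTS neTS; pose P U := [/\ is_subalgebra U, (U <= S)%VS & U <> S].
have [//|M [[algM sMS neMS] sTM maxM]] := @vspace_maximum P T.
exists M => //; split=> // U algU sMU sUS.
by have [->|neUS] := classic (U = S); [right|left; apply: maxM].
Qed.

Lemma maximal_subalgebra_add_line M S x :
    maximal_subalgebra_of M S -> x \in S -> x \notin M ->
    is_subalgebra (M + <[x]>)%VS -> (M + <[x]>)%VS = S.
Proof.
case=> _ sMS _ maxM Sx M'x algMx.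
have sMxS : (M + <[x]> <= S)%VS by rewrite subv_add sMS -memvE.
case: (maxM _ algMx (addvSl _ _) sMxS) => // eqM.
by case/negP: M'x; rewrite -eqM (subvP (addvSr _ _)) ?memv_line.
Qed.

(** * Engel's theorem *)

Definition adnil y := forall v, exists n, iter n (bracket y) v = 0.

Lemma iter_bracket_linear (y : L) (a : F) n u v :
  iter n (bracket y) (a *: u + v) =
    a *: iter n (bracket y) u + iter n (bracket y) v.
Proof. by elim: n => //= n ->; rewrite linearP. Qed.

Lemma iter_bracket0 y n : iter n (bracket y) 0 = 0.
Proof. by elim: n => //= n ->; rewrite linear0. Qed.

Lemma iter_bracket0_leq y m n v : (m <= n)%N ->
  iter m (bracket y) v = 0 -> iter n (bracket y) v = 0.
Proof. by move=> /subnK <- h; rewrite iterD h iter_bracket0. Qed.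

(* By induction a maximal subalgebra T of S is an ideal of codimension 1, say
   S = T + <[v]>, and some w in W \ U satisfies [T, w] <= U. As T is an ideal,
   so do its iterates under ad v, and the last one outside U is as required. *)
Lemma engel_step S : is_subalgebra S -> {in S, forall y, adnil y} ->
  forall U W, (U <= W)%VS -> U <> W ->
    (bracketv S U <= U)%VS -> (bracketv S W <= W)%VS ->
  exists v, [/\ v \in W, v \notin U & {in S, forall s, bracket s v \in U}].
Proof.
move: {2}_.+1 (ltnSn (\dim S)) => n.
elim: n S => [//|n IHn] S leSn algS nilS U W sUW neUW.
move=> /bracketv_leP SU /bracketv_leP SW.
have [S0|neS0] := eqVneq S 0%VS.
  have [v Wv U'v] := properv_exists sUW neUW; exists v; split=> // s.
  by rewrite S0 memv0 => /eqP->; rewrite bracket0l mem0v.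
have alg0 : is_subalgebra (0%VS : {vspace L}).
  apply/subalgebraP => u v; rewrite memv0 => /eqP-> _.
  by rewrite bracket0l mem0v.
have [T maxT _] := maximal_subalgebra_exists alg0 (sub0v S)
  (not_eq_sym (elimN eqP neS0)).
have [algT sTS neTS _] := maxT.
have leTn : (\dim T < n)%N by apply: leq_trans (properv_dim sTS neTS) leSn.
have nilT : {in T, forall y, adnil y} by move=> y /(subvP sTS); apply: nilS.
have [v [Sv T'v Tv]] : exists v,
    [/\ v \in S, v \notin T & {in T, forall s, bracket s v \in T}].
  apply: (IHn T) => //; apply/bracketv_leP => u v /(subvP sTS) Su Sv.
  by move/subalgebraP: algS; apply.
have defS := maximal_subalgebra_add_line maxT Sv T'v (subalgebra_add_line algT Tv).
have [w [Ww U'w Tw]] : exists w,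
    [/\ w \in W, w \notin U & {in T, forall s, bracket s w \in U}].
  apply: (IHn T) => //; apply/bracketv_leP => u z /(subvP sTS) Su;
    [exact: SU|exact: SW].
have [k vkw0] := nilS v Sv w.
elim: k w Ww U'w Tw vkw0 => [|k IHk] w Ww U'w Tw.
  by move=> /= w0; rewrite w0 mem0v in U'w.
rewrite iterSr; have [Uvw _|U'vw] := boolP (bracket v w \in U).
  exists w; split=> // s; rewrite -defS => /memv_addP[t Tt [_ /vlineP[a ->] ->]].
  by rewrite bracketDl bracketZl memvD ?memvZ ?Uvw ?Tw.
apply: IHk => //; first exact: SW.
move=> t Tt; rewrite bracket_derivation memvD ?Tw ?Tv //.
by apply: SU => //; apply: Tw.
Qed.

(** An [S]-stable [U] killed by iterated brackets with [S] is grown from 0 up to [S]: [engel_step]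
    yields [v] outside [U] with [S, v] inside [U], and adjoining [v] costs one more bracket. *)
Theorem engel S :
  is_subalgebra S -> {in S, forall y, adnil y} -> is_nilpotent S.
Proof.
move=> algS nilS; rewrite /is_nilpotent /lower_central.
have iterS n U V : (U <= V)%VS ->
    (iter n (bracketv S) U <= iter n (bracketv S) V)%VS.
  by move=> sUV; elim: n => //= n; apply: bracketvS.
suff climb n U : (\dim S - \dim U <= n)%N -> (U <= S)%VS ->
    (bracketv S U <= U)%VS -> (exists m, iter m (bracketv S) U = 0%VS) ->
    exists m, iter m (bracketv S) S = 0%VS.
  apply: (climb (\dim S) 0%VS); rewrite ?leq_subr ?sub0v //; last by exists 0%N.
  by apply/bracketv_leP => u v _; rewrite !memv0 => /eqP->; rewrite linear0.
elim: n U => [|n IHn] U leUn sUS stU [m Um0].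
  exists m; rewrite (_ : S = U :> {vspace L}) // in Um0 *.
  by apply/esym/eqP; rewrite eqEdim sUS -subn_eq0 -leqn0.
have [eqUS|neUS] := classic (U = S); first by exists m; rewrite -{2}eqUS.
have [v [Sv U'v Sv_U]] := engel_step algS nilS sUS neUS stU algS.
have sSU1 : (bracketv S (U + <[v]>) <= U)%VS.
  apply/bracketv_leP => s _ Ss /memv_addP[u Uu [_ /vlineP[a ->] ->]].
  rewrite linearD linearZ memvD ?memvZ ?Sv_U //.
  by apply: (bracketv_leP _ _ _ stU).
apply: (IHn (U + <[v]>)%VS).
- have neU1 : U <> (U + <[v]>)%VS.
    move=> eqU; case/negP: U'v; rewrite eqU.
    by rewrite (subvP (addvSr _ _)) ?memv_line.
  have ltU1 := properv_dim (addvSl U <[v]>) neU1.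
  rewrite -ltnS; apply: leq_trans leUn; apply: ltn_sub2l => //.
  exact: properv_dim.
- by rewrite subv_add sUS -memvE.
- exact: subv_trans sSU1 (addvSl _ _).
exists m.+1; rewrite iterSr; apply/eqP; rewrite -subv0 -Um0.
exact: iterS.
Qed.

(** * The Fitting null component *)

Lemma iter_bracket_bracket y m n u v :
  iter m (bracket y) u = 0 -> iter n (bracket y) v = 0 ->
  iter (m + n) (bracket y) (bracket u v) = 0.
Proof.
(* Induction on m + n: the Leibniz rule moves one [bracket y] onto [u] or onto [v], which lowers [m]
   or [n] by one. *)
elim: {m n}(m + n)%N {-2}m {-2}n u v (erefl (m + n)%N) =>
  [|k IHk] [|m] [|n] // u v.
- by move=> _ /= -> _; rewrite bracket0l.
- by move=> _ u0 _; rewrite [u]u0 bracket0l iter_bracket0.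
- by move=> _ _ v0; rewrite [v]v0 linear0 iter_bracket0.
move=> defk um0 vn0.
rewrite iterSr bracket_derivation -[bracket (bracket y u) v]scale1r.
rewrite iter_bracket_linear scale1r.
have [defk1 defk2] : (m + n.+1)%N = k /\ (m.+1 + n)%N = k.
  by move: defk; rewrite addSn addnS => -[<-]; rewrite addSn.
rewrite (IHk _ _ _ _ defk1) -?iterSr // add0r.
by rewrite -[X in iter X]/(m + n.+1)%N defk1 -defk2 IHk // -iterSr.
Qed.

(* The images of the powers of ad y stabilize, say at n; writing
   (ad y)^n v = (ad y)^(n+1) w gives v - [y, w] in the null component. *)
Lemma fitting_null_component y :
  exists K, [/\ is_subalgebra K,
                forall v, v \in K <-> exists n, iter n (bracket y) v = 0 &
                forall v, exists w, v - bracket y w \in K].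
Proof.
have [||K memK] := 
  @vspace_comprehension (fun v => exists n, iter n (bracket y) v = 0).
- by exists 0%N.
- move=> a u v [m um0] [n vn0]; exists (m + n)%N; rewrite iter_bracket_linear.
  rewrite (iter_bracket0_leq (leq_addr n m) um0)
    (iter_bracket0_leq (leq_addl m n) vn0).
  by rewrite scaler0 addr0.
exists K; split=> //.
  apply/subalgebraP => u v /memK[m um0] /memK[n vn0]; apply/memK.
  by exists (m + n)%N; apply: iter_bracket_bracket.
pose I n := iter n (lfun_img (ad y)) fullv.
have IP n v : v \in I n <-> exists w, v = iter n (bracket y) w.
  elim: n v => [|n IHn] v; first by split=> [_|]; [exists v|rewrite memvf].
  split=> [/memv_imgP[u /IHn[w ->] ->]|[w ->]]; first by exists w; rewrite adE.
  by rewrite /= -adE memv_img //; apply/IHn; exists w.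
have decI n : (I n.+1 <= I n)%VS.
  by apply/subvP => _ /IP[w ->]; apply/IP; exists (bracket y w);
    rewrite -iterSr.
have [n eqI] : exists n, I n.+1 = I n.
  apply: NNPP => neI; suff bound n : (\dim (I n) + n <= \dim {:L})%N.
    by have := bound (\dim {:L}).+1; rewrite addnS ltnNge leq_addl.
  elim: n => [|n]; first by rewrite addn0.
  apply: leq_trans; rewrite addnS ltn_add2r; apply: properv_dim (decI n) _ => eqI.
  by apply: neI; exists n.
move=> v; have /IP[w vE] : iter n (bracket y) v \in I n.+1.
  by rewrite eqI; apply/IP; exists v.
exists w; apply/memK; exists n.
by rewrite addrC -scaleN1r iter_bracket_linear vE iterSr scaleN1r addNr.
Qed.

(** * Subideal chains, idealizers and proper ideals *)

Lemma first_exit (P : nat -> bool) k : ~~ P 0%N -> P k ->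
  exists2 j, (j < k)%N & ~~ P j /\ P j.+1.
Proof.
elim: k => [|k IHk] nP0 Pk; first by rewrite Pk in nP0.
have [/(IHk nP0)[j ltjk Pj]|nPk] := boolP (P k); last by exists k.
by exists j => //; apply: ltnW.
Qed.

(** By the Jacobi identity [ad] turns brackets into commutators, so the idealizer is closed under
    brackets. *)
Lemma idealizer_exists S : is_subalgebra S ->
  exists U, is_subalgebra U /\
    forall v, v \in U <-> {in S, forall s, bracket v s \in S}.
Proof.
move=> algS; have [||U memU] :=
  @vspace_comprehension (fun v => {in S, forall s, bracket v s \in S}).
- by move=> s _; rewrite bracket0l mem0v.
- by move=> a u v hu hv s Ss; rewrite bracketDl bracketZl memvD ?memvZ ?hu ?hv.
exists U; split=> //; apply/subalgebraP => u v /memU hu /memU hv;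
  apply/memU => s Ss.
rewrite (_ : bracket (bracket u v) s =
  bracket u (bracket v s) - bracket v (bracket u s)).
  by rewrite memvB ?hu ?hv // ?hu ?hv.
by rewrite bracket_derivation addrK.
Qed.

(** Intersected with [M], the chain runs from [S] to [M]. Where it stops being [S] it becomes [M] by
    maximality, and the ideal relation of the chain passes to the intersections. *)
Lemma maximal_subideal_ideal S M :
    is_subalgebra M -> maximal_subalgebra_of S M -> is_subideal S ->
  is_ideal_of S M.
Proof.
move=> algM [_ sSM neSM maxS] [k [J [J0 Jk algJ idJ]]].
have [||j ltjk []] := @first_exit (fun j => J j :&: M != S)%VS k.
- by rewrite negbK J0; apply/eqP/capv_idPl.
- by rewrite Jk capfv; apply/eqP => /esym.
rewrite negbK => /eqP defS /eqP neS.
have /andP[sJ /bracketv_leP hJ] := idJ j ltjk.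
have sSJ : (S <= J j.+1 :&: M)%VS by rewrite -defS capvS.
have algJM := subalgebra_capv (algJ _ ltjk) algM.
have [//|defM] := maxS _ algJM sSJ (capvSr _ _).
rewrite /is_ideal_of sSM; apply/bracketv_leP => u v; rewrite -{1}defM -defS.
rewrite !memv_cap => /andP[Ju Mu] /andP[Jv Mv].
by rewrite hJ //; move/subalgebraP: algM; apply.
Qed.

(** The subalgebra I + Fx is Fx or the whole algebra; in the first case the nonzero [I] would fill
    the line and contain [x]. *)
Lemma ideal_add_line_maximal I x :
    is_ideal I -> I <> 0%VS ->
  maximal_subalgebra_of <[x]>%VS fullv -> x \notin I -> (I + <[x]>)%VS = fullv.
Proof.
move=> idI neI0 [_ _ _ maxx] I'x.
case: (maxx _ (ideal_add_line_subalgebra x idI) (addvSr _ _) (subvf _)) => // eqx.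
have [v Iv v0] := vspace_neq0 neI0.
have /vlineP[c vE] : v \in <[x]>%VS by rewrite -eqx (subvP (addvSl _ _)).
have c0 : c != 0 by apply: contraNneq v0 => c0; rewrite vE c0 scale0r.
by case/negP: I'x; rewrite -[x](scalerK c0) -vE memvZ.
Qed.

(** By Fitting, each [v] is an element of the null component plus some [y, w]; the latter lies in
    [M] because [y], itself in the null component, does. *)
Lemma ideal_null_component_fullv y M :
    (forall v, (exists n, iter n (bracket y) v = 0) -> v \in M) ->
  is_ideal M -> M = fullv.
Proof.
move=> nullM /idealP idM; apply/eqP; rewrite eqEsubv subvf; apply/subvP => v _.
have [K [_ memK /(_ v)[w /memK/nullM Mvw]]] := fitting_null_component y.
have My : y \in M by apply: nullM; exists 1%N; rewrite /= bracketxx.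
by rewrite -(subrK (bracket y w) v) memvD // (bracketC y) memvN idM.
Qed.

(** * Consequences of all 2-maximal subalgebras being subideals *)

Section TwoMaximalSubideals.
Hypothesis two_max_subideal : forall S, two_maximal_subalgebra S -> is_subideal S.

Section NonIdeal.
Variable M : {vspace L}.
Hypotheses (maxM : maximal_subalgebra_of M fullv) (nidM : ~ is_ideal M).

Lemma maximal_of_nonideal_is_ideal S : maximal_subalgebra_of S M -> is_ideal S.
Proof.
move=> maxS; have [algM _ neM maxMT] := maxM; have [algS sSM neSM maxST] := maxS.
have subS : is_subideal S by apply: two_max_subideal; exists M.
have /andP[_ /bracketv_leP idSM] := maximal_subideal_ideal algM maxS subS.
have [U [algU memU]] := idealizer_exists algS.
have sMU : (M <= U)%VS by apply/subvP => v Mv; apply/memU => s; apply: idSM.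
(* The idealizer [U] contains the maximal [M], so it is [M] or the whole algebra; in the latter case
   [S] is an ideal. *)
case: (maxMT U algU sMU (subvf U)) => [defU|defU]; last first.
  have hS u : {in S, forall s, bracket u s \in S}.
    by apply/memU; rewrite defU memvf.
  by apply/idealP => u v; apply: hS.
(* If the idealizer is [M], a contradiction comes from showing that [M] is an ideal, using the place
   where the chain leaves [M]. *)
case: nidM; have [k [J [J0 Jk algJ idJ]]] := subS.
have sSJ j : (j <= k)%N -> (S <= J j)%VS.
  elim: j => [|j IHj] ltjk; first by rewrite J0.
  by apply: subv_trans (IHj (ltnW ltjk)) _; case/andP: (idJ j ltjk).
have [||j ltjk []] := @first_exit (fun j => ~~ (J j <= M)%VS) k.
- by rewrite negbK J0.
- by rewrite Jk; apply/negP => sM; apply: neM; apply/eqP; rewrite eqEsubv subvf.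
rewrite negbK => sJM nsJM; have /andP[sJJ /bracketv_leP hJ] := idJ j ltjk.
(* The last term inside [M] is [S] or [M]. If it is [S], the next term normalizes [S] and so stays
   in [M], which is absurd; if it is [M], the next term is the whole algebra. *)
have [JS|JM] := maxST _ (algJ _ (ltnW ltjk)) (sSJ _ (ltnW ltjk)) sJM.
  case/negP: nsJM; rewrite -defU; apply/subvP => v Jv; apply/memU => s.
  by rewrite -JS; apply: hJ.
have sMJ : (M <= J j.+1)%VS by rewrite -JM.
case: (maxMT _ (algJ _ ltjk) sMJ (subvf _)) => [JM1|Jf].
  by rewrite JM1 subvv in nsJM.
by apply/idealP => u v; rewrite -JM; apply: hJ; rewrite Jf memvf.
Qed.

Lemma nonideal_maximal_line z : z \in M -> z != 0 -> M = <[z]>%VS.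
Proof.
move=> Mz z0; apply: NNPP => neMz; have [algM _ neM maxMT] := maxM.
have line_sub v : v \in M -> (<[v]> <= M)%VS by rewrite -memvE.
have [S maxS szS] := maximal_subalgebra_exists (line_subalgebra z)
  (line_sub _ Mz) (not_eq_sym neMz).
have idS := maximal_of_nonideal_is_ideal maxS.
have [_ sSM neSM _] := maxS; have [w Mw S'w] := properv_exists sSM neSM.
have defM := maximal_subalgebra_add_line maxS Mw S'w
  (ideal_add_line_subalgebra w idS).
(* Were [M] the line of [w], then [z] would be a nonzero multiple of [w], putting [w] in [S]. *)
have [eqw|new] := classic (<[w]>%VS = M).
  have /vlineP[c zE] : z \in <[w]>%VS by rewrite eqw.
  have c0 : c != 0 by apply: contraNneq z0 => c0; rewrite zE c0 scale0r.
  by case/negP: S'w; rewrite -[w](scalerK c0) -zE memvZ.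
have [T maxT swT] := maximal_subalgebra_exists (line_subalgebra w)
  (line_sub _ Mw) new.
have idT := maximal_of_nonideal_is_ideal maxT; have [_ sTM _ _] := maxT.
case: nidM; rewrite (_ : M = S + T)%VS; first exact: ideal_addv.
by apply/eqP; rewrite eqEsubv subv_add sSM sTM -{1}defM addvS.
Qed.
End NonIdeal.

(** A maximal subalgebra above the null component of [ad y] is not an ideal, so it is the line of
    [y]. An ideal containing [y] then contains the null component. *)
Lemma not_adnil_maximal_line y : ~ adnil y ->
  maximal_subalgebra_of <[y]>%VS fullv /\
  forall I, is_ideal I -> y \in I -> I = fullv.
Proof.
move=> nny; have [K [algK memK _]] := fitting_null_component y.
have neK : K <> fullv.
  by move=> Kf; apply: nny => v; apply/memK; rewrite Kf memvf.
have [M maxM sKM] := maximal_subalgebra_exists algK (subvf K) neK.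
have nullM v : (exists n, iter n (bracket y) v = 0) -> v \in M.
  by move/memK/(subvP sKM).
have [_ _ neM _] := maxM.
have nidM : ~ is_ideal M by move/(ideal_null_component_fullv nullM).
have y0 : y != 0.
  by apply/eqP => y0; apply: nny => v; exists 1%N; rewrite /= y0 bracket0l.
have My : y \in M by apply: nullM; exists 1%N; rewrite /= bracketxx.
have defM := nonideal_maximal_line maxM nidM My y0.
split=> [|I idI Iy]; first by rewrite -defM.
apply: (ideal_null_component_fullv (y := y)) idI => v /nullM.
by rewrite defM; apply: subvP; rewrite -memvE.
Qed.

Lemma nonnilpotent_cases : ~ is_nilpotent (@fullv F L) ->
  (exists N x, [/\ is_nilradical N, (N + <[x]>)%VS = fullv,
     bracketv N N = 0%VS & acts_irreducibly (ad x) N]) \/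
  (is_simple L /\
   forall S, is_subalgebra S -> S <> 0%VS -> S <> fullv -> \dim S = 1%N).
Proof.
move=> nnL; have [x nnx] : exists x, ~ adnil x.
  apply: not_all_ex_not => nilL; apply: nnL; apply: engel fullv_subalgebra _ => y _.
  exact: nilL.
have [maxx idx] := not_adnil_maximal_line nnx.
have LL0 : bracketv (@fullv F L) fullv <> 0%VS.
  by move=> LL0; apply: nnL; exists 1%N.
have [simpL|nsimpL] := classic (is_simple L);
  [right; split=> // S algS neS0 neSf|left].
  (* By simplicity the maximal [M] above [S] is not an ideal, so any nonzero [z] in [S] spans [M],
     and S = M. *)
  have [M maxM sSM] := maximal_subalgebra_exists algS (subvf S) neSf.
  have [_ _ neM _] := maxM.
  have [z Sz z0] := vspace_neq0 neS0; have Mz := subvP sSM _ Sz.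
  have nidM : ~ is_ideal M.
    case: simpL => _ /[apply] -[M0|//].
    by rewrite M0 memv0 (negPf z0) in Mz.
  suff -> : S = <[z]>%VS by rewrite dim_vline z0.
  apply/eqP; rewrite eqEsubv -memvE Sz andbT.
  by rewrite -(nonideal_maximal_line maxM nidM Mz z0).
have [I [idI neI0 neIf]] : exists I, [/\ is_ideal I, I <> 0%VS & I <> fullv].
  apply: NNPP => noI; apply: nsimpL; split=> // I idI; apply: NNPP => h.
  by apply: noI; exists I; split=> // h'; apply: h; [left|right].
pose N := bracketv (@fullv F L) fullv.
have idL : is_ideal (@fullv F L) by apply/idealP => u v _; rewrite memvf.
have idN : is_ideal N by apply: bracketv_ideal.
have defL J : is_ideal J -> J <> 0%VS -> J <> fullv ->
    (J + <[x]>)%VS = fullv /\ x \notin J.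
  move=> idJ neJ0 neJf; have J'x : x \notin J by apply/negP => /(idx J idJ).
  by split=> //; apply: ideal_add_line_maximal.
(* Every bracket falls into [J], since L = J + Fx and [x, x] = 0. *)
have sNJ J : is_ideal J -> J <> 0%VS -> J <> fullv -> (N <= J)%VS.
  move=> idJ neJ0 neJf; have [defJ _] := defL J idJ neJ0 neJf.
  apply/bracketv_leP => u v _ _.
  have /memv_addP[a Ja [_ /vlineP[c ->] ->]] : u \in (J + <[x]>)%VS.
    by rewrite defJ memvf.
  have /memv_addP[b Jb [_ /vlineP[d ->] ->]] : v \in (J + <[x]>)%VS.
    by rewrite defJ memvf.
  move/idealP: idJ => idJ.
  rewrite bracketDl !linearD /= !bracketZl !linearZ /= bracketxx !scaler0 addr0.
  by rewrite (bracketC a x) !(memvD, memvN, memvZ, idJ).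
have neNf : N <> fullv.
  move=> Nf; apply: (neIf); apply/eqP; rewrite eqEsubv subvf -Nf.
  exact: sNJ.
have [defN N'x] := defL N idN LL0 neNf.
(* A vector of [J] is a + cx with [a] in [N], hence in [J]; a nonzero [c] would put [x] in [J]. *)
have eqN J : is_ideal J -> J <> 0%VS -> J <> fullv -> J = N.
  move=> idJ neJ0 neJf; have [_ J'x] := defL J idJ neJ0 neJf.
  apply/eqP; rewrite eqEsubv sNJ // andbT; apply/subvP => v Jv.
  have /memv_addP[a Na [_ /vlineP[c ->] vE]] : v \in (N + <[x]>)%VS.
    by rewrite defN memvf.
  have [c0|c0] := eqVneq c 0; first by rewrite vE c0 scale0r addr0.
  case/negP: J'x; rewrite -[x](scalerK c0) memvZ //.
  by rewrite -(addKr a (c *: x)) -vE memvD ?memvN // (subvP (sNJ J _ _ _)).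
have nilN : is_nilpotent N.
  apply: engel (ideal_is_subalgebra idN) _ => y Ny; apply: NNPP => nny.
  by have [_ /(_ N idN Ny)] := not_adnil_maximal_line nny.
(* A nonzero [N, N] would equal [N], and the lower central series of [N] would be constant, against
   nilpotency. *)
have NN0 : bracketv N N = 0%VS.
  apply: NNPP => neNN; have eqNN : bracketv N N = N.
    apply: eqN => //; first exact: bracketv_ideal.
    move=> NNf; apply: neNf; apply/eqP; rewrite eqEsubv subvf -NNf.
    exact: ideal_is_subalgebra.
  have [n] := nilN; rewrite /lower_central => Nn0; apply: LL0; rewrite -/N -Nn0.
  by elim: n {Nn0} => //= n <-.
exists N, x; split=> //.
  split=> // J idJ nilJ; have [->|neJ0] := classic (J = 0%VS).
    exact: sub0v.
  by rewrite (eqN J) // => Jf; apply: nnL; rewrite -Jf.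
(* Since [N] is abelian and L = N + Fx, stability under [ad x] already makes [W] an ideal, so [eqN]
   applies. *)
move=> W sWN xW; have [|neW0] := classic (W = 0%VS); [by left|right].
apply: eqN => //; last first.
  by move=> Wf; apply: neNf; apply/eqP; rewrite eqEsubv subvf -Wf.
apply/idealP => u v Wv.
have /memv_addP[a Na [_ /vlineP[c ->] ->]] : u \in (N + <[x]>)%VS.
  by rewrite defN memvf.
rewrite bracketDl bracketZl memvD ?memvZ //; last first.
  by rewrite -adE (subvP xW) ?memv_img.
have : bracket a v \in bracketv N N.
  by apply: memv_bracket => //; apply: subvP Wv.
by rewrite NN0 memv0 => /eqP->; rewrite mem0v.
Qed.

End TwoMaximalSubideals.

(** * Converse: subideals in each of the three cases *)

Lemma subalgebra_add_ideal S I :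
  is_subalgebra S -> is_ideal I -> is_subalgebra (S + I)%VS.
Proof.
move=> /subalgebraP hS /idealP hI; apply/subalgebraP.
move=> _ _ /memv_addP[s Ss [c Ic ->]] /memv_addP[t St [d Id ->]].
rewrite bracketDl !linearD /= -addrA memv_add ?hS //.
by rewrite (bracketC c) !(memvD, memvN, hI).
Qed.

Lemma nilpotent_is_subideal S :
  is_nilpotent (@fullv F L) -> is_subalgebra S -> is_subideal S.
Proof.
move=> [k Lk0] algS; pose C := lower_central (@fullv F L).
have idC n : is_ideal (C n).
  elim: n => [|n IHn]; first by apply/idealP => u v _; rewrite memvf.
  by apply: bracketv_ideal => //; apply/idealP => u v _; rewrite memvf.
have CS n u v : v \in C n -> bracket u v \in C n.+1.
  by move=> Cv; apply: memv_bracket; rewrite ?memvf.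
have decC n : (C n.+1 <= C n)%VS by case/andP: (idC n).
have idSC n : is_ideal_of (S + C n.+1)%VS (S + C n)%VS.
  rewrite /is_ideal_of addvS ?decC //; apply/bracketv_leP.
  move=> _ _ /memv_addP[s Ss [c Cc ->]] /memv_addP[t St [d Cd ->]].
  rewrite bracketDl !linearD /= -addrA memv_add //.
    exact: (subalgebraP _ algS).
  have CD u : bracket u d \in C n.+1 by apply/CS/(subvP (decC n)).
  by rewrite (bracketC c t) !(memvD, memvN, CD, CS).
(* The lower central series is read backwards: the chain starts at S + C k = S and ends at S + C 0,
   the whole algebra. *)
exists k, (fun j => S + C (k - j)%N)%VS; split=> [||j _|j ltjk].
- by rewrite subn0 [C k]Lk0 addv0.
- by rewrite subnn [C 0%N]/lower_central /=; apply/eqP;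
    rewrite eqEsubv subvf addvSr.
- exact: subalgebra_add_ideal.
by have := idSC (k - j.+1)%N; rewrite -subSn // subSS.
Qed.

(** Proper subalgebras outside [N] are lines, and a line is not properly contained in another. So
    [S] lies in the abelian ideal [N], and S, N, L is the required chain. *)
Lemma abelian_irreducible_two_maximal_subideal N x S :
    is_ideal N -> (N + <[x]>)%VS = fullv -> bracketv N N = 0%VS ->
    acts_irreducibly (ad x) N ->
  two_maximal_subalgebra S -> is_subideal S.
Proof.
move=> idN defL NN0 irrN.
have abN u v : u \in N -> v \in N -> bracket u v = 0.
  by move=> Nu Nv; apply/eqP; rewrite -memv0 -NN0 memv_bracket.
(* For t = a + cx in [T] with [c] nonzero, [ad t] agrees on [N] with c times [ad x], so T ∩ N is 0
   or [N] by irreducibility. Then [T] is the line of [t], respectively the whole algebra. *)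
have dimT T : is_subalgebra T -> T <> fullv -> ~~ (T <= N)%VS -> \dim T = 1%N.
  move=> algT neT /subvPn[t Tt N't].
  have /memv_addP[a Na [_ /vlineP[c ->] tE]] : t \in (N + <[x]>)%VS.
    by rewrite defL memvf.
  have c0 : c != 0 by apply: contraNneq N't => c0; rewrite tE c0 scale0r addr0.
  have defT : (N + <[t]>)%VS = fullv.
    apply/eqP; rewrite eqEsubv subvf -defL subv_add addvSl -memvE.
    rewrite -[x](scalerK c0) memvZ // -(addKr a (c *: x)) -tE.
    by rewrite memv_add ?memvN ?memv_line.
  have [||TN0|TN] := irrN (T :&: N)%VS; first exact: capvSr.
  - apply/subvP => _ /memv_imgP[v + ->]; rewrite adE !memv_cap => /andP[Tv Nv].
    have -> : bracket x v = c^-1 *: bracket t v.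
      by rewrite tE bracketDl bracketZl (abN a) // add0r scalerK.
    by rewrite !memvZ ?(subalgebraP _ algT) // ?(idealP _ idN).
  - suff -> : T = <[t]>%VS.
      by rewrite dim_vline; case: eqP N't => // ->; rewrite mem0v.
    apply/eqP; rewrite eqEsubv -memvE Tt andbT; apply/subvP => v Tv.
    have /memv_addP[b Nb [d td vE]] : v \in (N + <[t]>)%VS.
      by rewrite defT memvf.
    suff -> : v = d by [].
    have : b \in (T :&: N)%VS.
      have Td : d \in T by move: d td {vE} => _ /vlineP[e ->]; rewrite memvZ.
      by rewrite memv_cap Nb andbT -(addrK d b) -vE memvB.
    by rewrite TN0 memv0 vE => /eqP->; rewrite add0r.
  case: neT; apply/eqP; rewrite eqEsubv subvf -defT subv_add -memvE Tt andbT.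
  by rewrite -TN capvSl.
case=> M [[algS sSM neSM _] [algM _ neM _]].
have sSN : (S <= N)%VS.
  apply/negPn/negP => nSN.
  have nMN : ~~ (M <= N)%VS by apply: contra nSN; apply: subv_trans sSM.
  have neS : S <> fullv.
    by move=> Sf; apply: neM; apply/eqP; rewrite eqEsubv subvf -Sf.
  by have := properv_dim sSM neSM; rewrite !dimT.
exists 2%N, (fun j => if j is j'.+1 then if j' is 0 then N else fullv else S).
split=> // [[|[|j]]|[|[|//]]] _ //.
- exact: ideal_is_subalgebra.
- exact: fullv_subalgebra.
- rewrite /is_ideal_of sSN; apply/bracketv_leP => u v Nu Sv.
  by rewrite abN ?mem0v // (subvP sSN).
Qed.

(** A nonzero [S] would be a line strictly inside another line, so [S] is 0, an ideal of the whole
    algebra. *)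
Lemma two_maximal_of_lines_subideal S :
    (forall T, is_subalgebra T -> T <> 0%VS -> T <> fullv -> \dim T = 1%N) ->
  two_maximal_subalgebra S -> is_subideal S.
Proof.
move=> lineT [M [[algS sSM neSM _] [algM _ neM _]]].
have [S0|neS0] := classic (S = 0%VS).
  exists 1%N, (fun j => if j is 0 then S else fullv); split=> // [[|j]|[|//]] _ //.
    exact: fullv_subalgebra.
  rewrite S0 /is_ideal_of sub0v; apply/bracketv_leP => u v _.
  by rewrite !memv0 => /eqP->; rewrite linear0.
have neM0 : M <> 0%VS.
  by move=> M0; apply: neS0; apply/eqP; rewrite -subv0 -M0.
have neS : S <> fullv.
  by move=> Sf; apply: neM; apply/eqP; rewrite eqEsubv subvf -Sf.
by have := properv_dim sSM neSM; rewrite !lineT.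
Qed.

End LieAlgebraTheory.

Theorem theorem2p3 (F : fieldType) (L : lieAlgType F) :
  (forall S : {vspace L}, two_maximal_subalgebra S -> is_subideal S) <->
  [\/ is_nilpotent (@fullv F L),
      exists (N : {vspace L}) (x : L),
        [/\ is_nilradical N, (N + <[x]>)%VS = fullv,
            bracketv N N = 0%VS & acts_irreducibly (ad x) N]
    | is_simple L /\
      forall S : {vspace L}, is_subalgebra S ->
        S <> 0%VS -> S <> fullv -> \dim S = 1%N].
Proof.
split=> [subL|].
  have [|nnL] := classic (is_nilpotent (@fullv F L)); first by constructor 1.
  by have [?|?] := nonnilpotent_cases subL nnL; [constructor 2|constructor 3].
case=> [nilL|[N [x [[idN _ _] defL NN0 irrN]]]|[_ lineL]] S twoS.
- by case: twoS => M [[algS _ _ _] _]; apply: nilpotent_is_subideal.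
- exact: abelian_irreducible_two_maximal_subideal idN defL NN0 irrN twoS.
- exact: two_maximal_of_lines_subideal twoS.
Qed.
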